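(* Let $\mathbb{I}$ be a consistent interval. Then every based Segal complete type $C$ that is a set is Sierpiński complete; that is, for every type $Z$, the restriction map $C^{\sigma_Z}\colon C^{L(Z)}\to C^{Z_\bot}$, $g\mapsto g\circ\sigma_Z$, is an equivalence.
   Context: We work in homotopy type theory (univalent foundations); ''isomorphism'' of types means equivalence, and a set is a 0-truncated type. An interval is a set $\mathbb{I}$ with a bounded meet-semilattice structure $(0,1,\sqcap)$; write $i\sqsubseteq j$ for $i\sqcap j=i$. For $i:\mathbb{I}$ let $[\![i]\!]:\equiv (i=1)$, a proposition. The interval is consistent if $0\neq 1$. For $j:\mathbb{I}$, $\mathbb{I}/j:\equiv\{i:\mathbb{I}\mid i\sqsubseteq j\}$. For a map $f\colon A\to B$, a type $X$ is $f$-local if $X^f\colon X^B\to X^A$, $g\mapsto g\circ f$, is an equivalence. The join $P*X$ of types is the pushout of $P\leftarrow P\times X\to X$ (for propositions it is disjunction). The Sierpiński cone of a type $X$ is $X_\bot:\equiv\sum_{i:\mathbb{I}}(i=0)*X$ (equivalently the pushout of $\{\bot\}\leftarrow X\to\mathbb{I}\times X$, $x\mapsto(0,x)$). For $j:\mathbb{I}$, $[\![j]\!]_\bot$ is the Sierpiński cone of the proposition $[\![j]\!]$, so $[\![j]\!]_\bot\simeq\{i:\mathbb{I}\mid i=0\lor j=1\}$, and it includes into $\mathbb{I}/j$ via $i\mapsto i$. A type $X$ is based Segal complete if for every $j:\mathbb{I}$ it is local with respect to the inclusion $[\![j]\!]_\bot\hookrightarrow\mathbb{I}/j$. The partial map classifier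 is $L(X):\equiv\sum_{i:\mathbb{I}}X^{[\![i]\!]}$. For consistent $\mathbb{I}$, the comparison map $\sigma_X\colon X_\bot\to L(X)$ is the map over $\mathbb{I}$ given on the fibre over $i$ by the map $(i=0)*X\to X^{[\![i]\!]}$ induced by $x\mapsto\lambda\_.x$ on $X$ and by the unique map $(i=0)\to X^{[\![i]\!]}$ (as $i=0$ and $i=1$ are contradictory). A type $C$ is Sierpiński complete if it is $\sigma_Z$-local for every type $Z$. *)

(* Defs.v *)
From Stdlib Require Import FunctionalExtensionality PropExtensionality
  ProofIrrelevance ClassicalEpsilon.

(* Types are the types of [Type], and identity types are [eq].  None of the
   definitions below uses uniqueness of identity proofs or univalence: a type
   is a set only when [is_set] says so.  Function extensionality is used once,
   in [sigma_fibre_glue]. *)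

(** * Equivalences, sets, local types *)

Definition is_set (A : Type) : Prop := forall (x y : A) (p q : x = y), p = q.

Definition is_contr (A : Type) : Type := {c : A & forall x : A, c = x}.

Definition fiber {A B : Type} (f : A -> B) (b : B) : Type := {a : A & f a = b}.

Definition is_equiv {A B : Type} (f : A -> B) : Type :=
  forall b : B, is_contr (fiber f b).

Definition is_local {A B : Type} (f : A -> B) (X : Type) : Type :=
  is_equiv (fun (g : B -> X) (a : A) => g (f a)).

(** * Pushouts and joins *)

Definition cocone {S A B : Type} (f : S -> A) (g : S -> B) (X : Type) : Type :=
  {h : A -> X & {k : B -> X & forall s : S, h (f s) = k (g s)}}.

Definition cocone_comp {S A B : Type} {f : S -> A} {g : S -> B} {P : Type}
    (inl : A -> P) (inr : B -> P) (glue : forall s : S, inl (f s) = inr (g s))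
    (X : Type) (m : P -> X) : cocone f g X :=
  existT _ (fun a => m (inl a))
    (existT _ (fun b => m (inr b)) (fun s => f_equal m (glue s))).

(* Rocq has no higher inductive types, so the pushouts of homotopy type theory
   are a structure, given by their universal property. *)
Record pushouts : Type := Pushouts {
  pushout : forall {S A B : Type}, (S -> A) -> (S -> B) -> Type;
  po_inl : forall {S A B : Type} (f : S -> A) (g : S -> B), A -> pushout f g;
  po_inr : forall {S A B : Type} (f : S -> A) (g : S -> B), B -> pushout f g;
  po_glue : forall {S A B : Type} (f : S -> A) (g : S -> B) (s : S),
    po_inl f g (f s) = po_inr f g (g s);
  po_universal : forall {S A B : Type} (f : S -> A) (g : S -> B) (X : Type),
    is_equiv (cocone_comp (po_inl f g) (po_inr f g) (po_glue f g) X)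
}.

Definition join (PO : pushouts) (P X : Type) : Type :=
  pushout PO (fun z : P * X => fst z) (fun z : P * X => snd z).

Definition join_rec (PO : pushouts) {P X Y : Type} (h : P -> Y) (k : X -> Y)
    (e : forall (p : P) (x : X), h p = k x) : join PO P X -> Y :=
  projT1 (projT1
    (po_universal PO (fun z : P * X => fst z) (fun z : P * X => snd z) Y
      (existT _ h (existT _ k (fun z => e (fst z) (snd z)))))).

(** * Intervals *)

(* The semilattices of MathComp carry decidable equality and a choice operator,
   which an interval need not have. *)
Record interval : Type := Interval {
  carrier :> Type;
  i0 : carrier;
  i1 : carrier;
  meet : carrier -> carrier -> carrier;
  carrier_set : is_set carrier;
  meetA : forall i j k : carrier, meet i (meet j k) = meet (meet i j) k;
  meetC : forall i j : carrier, meet i j = meet j i;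
  meetxx : forall i : carrier, meet i i = i;
  meet0x : forall i : carrier, meet i0 i = i0;
  meet1x : forall i : carrier, meet i1 i = i
}.

Arguments i0 {_}.
Arguments i1 {_}.
Arguments meet {_} _ _.

Definition below {I : interval} (i j : I) : Prop := meet i j = i.

Definition consistent (I : interval) : Prop := (i0 : I) <> i1.

Definition holds {I : interval} (i : I) : Prop := i = i1.

Definition slice {I : interval} (j : I) : Type := {i : I & below i j}.

(** * Sierpinski cones and based Segal completeness *)

Definition sierpinski_cone (PO : pushouts) (I : interval) (X : Type) : Type :=
  {i : I & join PO (i = i0) X}.

Lemma below_of_eq0 {I : interval} (i j : I) : i = i0 -> below i j.
Proof. intros ->; exact (meet0x I j). Qed.

Lemma below_of_holds {I : interval} (i j : I) : holds j -> below i j.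
Proof.
  unfold holds, below; intros ->; rewrite meetC; exact (meet1x I i).
Qed.

Definition cone_to_slice (PO : pushouts) {I : interval} (j : I)
    (w : sierpinski_cone PO I (holds j)) : slice j :=
  existT _ (projT1 w)
    (join_rec PO (below_of_eq0 (projT1 w) j) (below_of_holds (projT1 w) j)
      (fun _ _ => carrier_set I _ _ _ _) (projT2 w)).

Definition based_segal_complete (PO : pushouts) (I : interval) (C : Type)
  : Type := forall j : I, is_local (cone_to_slice PO j) C.

(** * The partial map classifier and Sierpinski completeness *)

Definition partial_map (I : interval) (X : Type) : Type :=
  {i : I & holds i -> X}.

Definition sigma_fibre_inl {I : interval} (I01 : consistent I) (X : Type)
    (i : I) (e : i = i0) : holds i -> X :=
  fun p => False_rect X (I01 (eq_trans (eq_sym e) p)).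

Definition sigma_fibre_inr {I : interval} (X : Type) (i : I) (x : X)
  : holds i -> X := fun _ => x.

Lemma sigma_fibre_glue {I : interval} (I01 : consistent I) (X : Type)
    (i : I) (e : i = i0) (x : X) :
  sigma_fibre_inl I01 X i e = sigma_fibre_inr X i x.
Proof.
  apply functional_extensionality; intros p.
  destruct (I01 (eq_trans (eq_sym e) p)).
Qed.

Definition sigma (PO : pushouts) {I : interval} (I01 : consistent I)
    (X : Type) (w : sierpinski_cone PO I X) : partial_map I X :=
  existT _ (projT1 w)
    (join_rec PO (sigma_fibre_inl I01 X (projT1 w))
      (sigma_fibre_inr X (projT1 w)) (sigma_fibre_glue I01 X (projT1 w))
      (projT2 w)).

Definition sierpinski_complete (PO : pushouts) (I : interval)
    (I01 : consistent I) (C : Type) : Type :=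
  forall Z : Type, is_local (sigma PO I01 Z) C.

(** * Existence of pushouts *)

(* Under proof irrelevance and choice, the set quotient of [A + B] has the
   universal property, so [pushouts] is inhabited. *)
Section PushoutsExist.

Context {S A B : Type} (f : S -> A) (g : S -> B).

Inductive po_rel : A + B -> A + B -> Prop :=
| po_rel_glue s : po_rel (inl (f s)) (inr (g s))
| po_rel_refl x : po_rel x x
| po_rel_sym x y : po_rel x y -> po_rel y x
| po_rel_trans x y z : po_rel x y -> po_rel y z -> po_rel x z.

Definition po_quot : Type :=
  {c : A + B -> Prop | exists x : A + B, c = po_rel x}.

Definition po_class (x : A + B) : po_quot :=
  exist _ (po_rel x) (ex_intro _ x eq_refl).

Definition po_repr (c : po_quot) : A + B :=
  proj1_sig (constructive_indefinite_description _ (proj2_sig c)).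

Lemma po_class_repr (c : po_quot) : po_class (po_repr c) = c.
Proof.
  unfold po_repr; destruct (constructive_indefinite_description _ _) as [x E].
  destruct c as [c H]; simpl in E; subst c; apply subset_eq_compat; reflexivity.
Qed.

Lemma po_class_eq (x y : A + B) : po_rel x y -> po_class x = po_class y.
Proof.
  intros R; apply subset_eq_compat, functional_extensionality; intros z.
  apply propositional_extensionality; split; intros Q.
  - exact (po_rel_trans _ _ _ (po_rel_sym _ _ R) Q).
  - exact (po_rel_trans _ _ _ R Q).
Qed.

Lemma po_repr_class (x : A + B) : po_rel (po_repr (po_class x)) x.
Proof.
  assert (E := f_equal (@proj1_sig _ _) (po_class_repr (po_class x))).
  simpl in E; rewrite E; apply po_rel_refl.
Qed.

Definition po_quot_glue (s : S) :
    po_class (inl (f s)) = po_class (inr (g s)) :=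
  po_class_eq _ _ (po_rel_glue s).

Lemma cocone_eq (X : Type) (u v : cocone f g X) :
  projT1 u = projT1 v -> projT1 (projT2 u) = projT1 (projT2 v) -> u = v.
Proof.
  destruct u as [h [k e]], v as [h' [k' e']]; simpl; intros -> ->.
  rewrite (proof_irrelevance _ e e'); reflexivity.
Qed.

Lemma po_quot_universal (X : Type) :
  is_equiv (cocone_comp (fun a => po_class (inl a)) (fun b => po_class (inr b))
              po_quot_glue X).
Proof.
  intros [h [k e]].
  set (hk := fun x : A + B => match x with inl a => h a | inr b => k b end).
  assert (hkE : forall x y, po_rel x y -> hk x = hk y).
  { intros x y R; induction R; simpl; auto; congruence. }
  assert (E : cocone_comp (fun a => po_class (inl a))
                (fun b => po_class (inr b)) po_quot_glue X
                (fun c => hk (po_repr c)) = existT _ h (existT _ k e)).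
  { apply cocone_eq; apply functional_extensionality; intros x;
      exact (hkE _ _ (po_repr_class _)). }
  exists (existT _ (fun c => hk (po_repr c)) E); intros [m Em].
  assert (M : (fun c => hk (po_repr c)) = m).
  { apply functional_extensionality; intros c.
    assert (Eh := f_equal (@projT1 _ _) Em); simpl in Eh.
    assert (Ek := f_equal (fun u => projT1 (projT2 u)) Em); simpl in Ek.
    rewrite <- (po_class_repr c) at 2; unfold hk.
    destruct (po_repr c); [rewrite <- Eh | rewrite <- Ek]; reflexivity. }
  destruct M; rewrite (proof_irrelevance _ E Em); reflexivity.
Qed.

End PushoutsExist.

Definition pushouts_exist : pushouts :=
  Pushouts (@po_quot) (fun S A B f g a => po_class f g (inl a))
    (fun S A B f g b => po_class f g (inr b)) (@po_quot_glue)
    (@po_quot_universal).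

(* Main.v *)
Require Import Defs.
From Stdlib Require Import FunctionalExtensionality.

(** A point [(j, h)] of [L(Z)] extends to the map [I/j -> L(Z)] sending [i] to
    the restriction of [h] along [holds i -> holds j]; it has value [(j, h)] at
    [j], and on the cone of [holds j] it factors through [sigma] via the map
    induced by [h] on cones.  Hence a map [g : Z_bot -> C] can be extended to
    [(j, h)] only by pulling [g] back along [h] to the cone of [holds j],
    extending to [I/j] by based Segal completeness, and evaluating at [j].
    Joins only give a map out of a cone up to the glue paths, which is why [C]
    has to be a set. *)

Lemma sig_eq {A : Type} {P : A -> Type} (x y : A) (u : P x) (v : P y)
    (e : x = y) :
  eq_rect x P u y e = v -> existT P x u = existT P y v.
Proof. destruct e; intros <-; reflexivity. Qed.

(* Hedberg's argument: [collapse] is a weakly constant endofunction of the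
   identity types of [A -> B]. *)
Lemma is_set_arrow (A B : Type) : is_set B -> is_set (A -> B).
Proof.
  intros HB f g.
  set (collapse := fun (f g : A -> B) (p : f = g) =>
    functional_extensionality f g
      (fun x => f_equal (fun k : A -> B => k x) p)).
  assert (const : forall p q : f = g, collapse f g p = collapse f g q).
  { intros p q; unfold collapse; f_equal.
    apply functional_extensionality_dep; intros x; apply HB. }
  assert (factor : forall p : f = g,
    p = eq_trans (eq_sym (collapse f f eq_refl)) (collapse f g p)).
  { intros p; destruct p; destruct (collapse f f eq_refl); reflexivity. }
  intros p q; rewrite (factor p), (factor q), (const p q); reflexivity.
Qed.

Definition equiv_inv {A B : Type} {f : A -> B} (H : is_equiv f) (b : B) : A :=
  projT1 (projT1 (H b)).

Lemma equiv_invK {A B : Type} {f : A -> B} (H : is_equiv f) (b : B) :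
  f (equiv_inv H b) = b.
Proof. exact (projT2 (projT1 (H b))). Qed.

(** Both [x] and [y] give points of the contractible fibre over [f y]. *)
Lemma equiv_inj {A B : Type} {f : A -> B} (H : is_equiv f) (x y : A) :
  f x = f y -> x = y.
Proof.
  intros E; destruct (H (f y)) as [c Hc].
  assert (Ex := f_equal (@projT1 _ _) (Hc (existT _ x E))).
  assert (Ey := f_equal (@projT1 _ _) (Hc (existT _ y eq_refl))).
  simpl in Ex, Ey; congruence.
Qed.

(** As [B] is a set, two points of a fibre agree once their first components do. *)
Lemma is_equiv_of_inverse {A B : Type} (f : A -> B) (s : B -> A) :
  is_set B -> (forall b, f (s b) = b) -> (forall a, s (f a) = a) -> is_equiv f.
Proof.
  intros HB fs sf b; exists (existT _ (s b) (fs b)); intros [a <-].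
  apply (sig_eq _ _ _ _ (sf a)), HB.
Qed.

Section Join.

Context (PO : pushouts).

Definition join_inl {P X : Type} (p : P) : join PO P X := po_inl PO _ _ p.

Definition join_inr {P X : Type} (x : X) : join PO P X := po_inr PO _ _ x.

Lemma join_glue {P X : Type} (p : P) (x : X) :
  join_inl p = join_inr x :> join PO P X.
Proof. exact (po_glue PO (fun z : P * X => fst z) (fun z => snd z) (p, x)). Qed.

Section Rec.

Context {P X Y : Type} (h : P -> Y) (k : X -> Y)
  (e : forall (p : P) (x : X), h p = k x).

Lemma join_rec_cocone :
  cocone_comp (po_inl PO _ _) (po_inr PO _ _) (po_glue PO _ _) Y
    (join_rec PO h k e)
  = existT _ h (existT _ k (fun z : P * X => e (fst z) (snd z))).
Proof. exact (equiv_invK (po_universal PO _ _ Y) _). Qed.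

Lemma join_rec_inl (p : P) : join_rec PO h k e (join_inl p) = h p.
Proof. exact (f_equal (fun c => projT1 c p) join_rec_cocone). Qed.

Lemma join_rec_inr (x : X) : join_rec PO h k e (join_inr x) = k x.
Proof. exact (f_equal (fun c => projT1 (projT2 c) x) join_rec_cocone). Qed.

End Rec.

(** In a set the homotopies of two cocones agree, so the legs decide; this replaces the proof
    irrelevance of [cocone_eq]. *)
Lemma cocone_eq_set {S A B X : Type} (f : S -> A) (g : S -> B)
    (u v : cocone f g X) :
  is_set X -> (forall a, projT1 u a = projT1 v a) ->
  (forall b, projT1 (projT2 u) b = projT1 (projT2 v) b) -> u = v.
Proof.
  intros HX; destruct u as [h [k e]], v as [h' [k' e']]; simpl; intros Eh Ek.
  apply functional_extensionality in Eh; apply functional_extensionality in Ek.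
  destruct Eh, Ek; do 2 f_equal.
  apply functional_extensionality_dep; intros s; apply HX.
Qed.

(** The uniqueness half of the universal property, with the condition on glue paths discharged by
    [is_set Y]. *)
Lemma join_ext {P X Y : Type} (m m' : join PO P X -> Y) :
  is_set Y -> (forall p, m (join_inl p) = m' (join_inl p)) ->
  (forall x, m (join_inr x) = m' (join_inr x)) -> forall w, m w = m' w.
Proof.
  intros HY El Er w; apply (f_equal (fun k => k w)).
  apply (equiv_inj (po_universal PO _ _ Y)), cocone_eq_set; assumption.
Qed.

Definition cone_map {I : interval} {X Y : Type} (f : X -> Y)
    (w : sierpinski_cone PO I X) : sierpinski_cone PO I Y :=
  existT _ (projT1 w)
    (join_rec PO join_inl (fun x => join_inr (f x))
      (fun e x => join_glue e (f x)) (projT2 w)).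

End Join.

Lemma slice_eq {I : interval} (j i : I) (b b' : below i j) :
  existT (fun k => below k j) i b = existT (fun k => below k j) i b'.
Proof. f_equal; apply carrier_set. Qed.

Lemma holds_of_below {I : interval} (i j : I) : below i j -> holds i -> holds j.
Proof. unfold below, holds; intros H ->; rewrite meet1x in H; exact H. Qed.

Definition slice_to_partial {I : interval} {Z : Type} (j : I) (h : holds j -> Z)
    (s : slice j) : partial_map I Z :=
  existT _ (projT1 s) (fun p => h (holds_of_below _ _ (projT2 s) p)).

Lemma slice_to_partial_top {I : interval} {Z : Type} (j : I) (h : holds j -> Z) :
  slice_to_partial j h (existT _ j (meetxx I j)) = existT _ j h.
Proof.
  unfold slice_to_partial; simpl; f_equal.
  apply functional_extensionality; intros p; f_equal; apply carrier_set.
Qed.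

Section Completeness.

Context (PO : pushouts) (I : interval) (I01 : consistent I) (C : Type)
  (HC : is_set C) (segal : based_segal_complete PO I C) (Z : Type).

Lemma sigma_inl (i : I) (e : i = i0) :
  sigma PO I01 Z (existT _ i (join_inl PO e))
  = existT _ i (sigma_fibre_inl I01 Z i e).
Proof. unfold sigma; simpl; f_equal; apply join_rec_inl. Qed.

Lemma sigma_inr (i : I) (z : Z) :
  sigma PO I01 Z (existT _ i (join_inr PO z)) = existT _ i (fun _ => z).
Proof. unfold sigma; simpl; f_equal; apply join_rec_inr. Qed.

Lemma cone_map_inl {X : Type} (f : X -> Z) (i : I) (e : i = i0) :
  cone_map PO f (existT _ i (join_inl PO e)) = existT _ i (join_inl PO e).
Proof. unfold cone_map; simpl; f_equal; apply join_rec_inl. Qed.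

Lemma cone_map_inr {X : Type} (f : X -> Z) (i : I) (x : X) :
  cone_map PO f (existT _ i (join_inr PO x)) = existT _ i (join_inr PO (f x)).
Proof. unfold cone_map; simpl; f_equal; apply join_rec_inr. Qed.

(** The two ways from the cone of [holds j] to [partial_map I Z] agree. They are compared after [G]
    because [join_ext] needs a set as target, and [partial_map I Z] need not be one. *)
Lemma sigma_cone_map (G : partial_map I Z -> C) (j : I) (h : holds j -> Z)
    (w : sierpinski_cone PO I (holds j)) :
  G (sigma PO I01 Z (cone_map PO h w))
  = G (slice_to_partial j h (cone_to_slice PO j w)).
Proof.
  destruct w as [i w]; revert w.
  apply (join_ext PO
    (fun w => G (sigma PO I01 Z (cone_map PO h (existT _ i w))))
    (fun w => G (slice_to_partial j h (cone_to_slice PO j (existT _ i w))))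
    HC).
  (* Over [i = i0] both partial maps have empty domain, by consistency. *)
  - intros e; rewrite cone_map_inl, sigma_inl.
    unfold slice_to_partial; simpl; do 2 f_equal.
    apply functional_extensionality; intros p.
    destruct (I01 (eq_trans (eq_sym e) p)).
  (* Both partial maps are constant at [h p], since [holds j] is a proposition. *)
  - intros p; rewrite cone_map_inr, sigma_inr.
    unfold slice_to_partial; simpl; do 2 f_equal.
    apply functional_extensionality; intros q; f_equal; apply carrier_set.
Qed.

Definition segal_lift (g : sierpinski_cone PO I Z -> C) (y : partial_map I Z)
  : C :=
  equiv_inv (segal (projT1 y)) (fun w => g (cone_map PO (projT2 y) w))
    (existT _ (projT1 y) (meetxx I (projT1 y))).

(** Restriction from [slice j] to the cone is injective, so the lift can be computed from any
    extension [v] that one can guess. *)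
Lemma segal_lift_unique (g : sierpinski_cone PO I Z -> C) (j : I)
    (h : holds j -> Z) (v : slice j -> C) :
  (forall w, v (cone_to_slice PO j w) = g (cone_map PO h w)) ->
  segal_lift g (existT _ j h) = v (existT _ j (meetxx I j)).
Proof.
  intros E; unfold segal_lift; simpl.
  apply (f_equal (fun k : slice j -> C => k (existT _ j (meetxx I j)))).
  apply (equiv_inj (segal j)); rewrite (equiv_invK (segal j)).
  apply functional_extensionality; intros w; symmetry; apply E.
Qed.

Lemma segal_lift_restrict (G : partial_map I Z -> C) (y : partial_map I Z) :
  segal_lift (fun w => G (sigma PO I01 Z w)) y = G y.
Proof.
  destruct y as [j h].
  rewrite (segal_lift_unique _ j h (fun s => G (slice_to_partial j h s))).
  - rewrite slice_to_partial_top; reflexivity.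
  - intros w; symmetry; apply sigma_cone_map.
Qed.

Lemma segal_lift_sigma (g : sierpinski_cone PO I Z -> C)
    (w : sierpinski_cone PO I Z) :
  segal_lift g (sigma PO I01 Z w) = g w.
Proof.
  destruct w as [i w]; revert w.
  apply (join_ext PO (fun w => segal_lift g (sigma PO I01 Z (existT _ i w)))
    (fun w => g (existT _ i w)) HC).
  - intros e; rewrite sigma_inl; unfold segal_lift; simpl.
    set (u := fun w => g (cone_map PO (sigma_fibre_inl I01 Z i e) w)).
    (* As [i = 0], the top of [I/i] already lies in the cone of [holds i]. *)
    assert (E : existT _ i (meetxx I i)
      = cone_to_slice PO i (existT _ i (join_inl PO e))) by apply slice_eq.
    rewrite E.
    etransitivity.
    + exact (f_equal (fun k => k (existT _ i (join_inl PO e)))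
        (equiv_invK (segal i) u)).
    + unfold u; rewrite cone_map_inl; reflexivity.
  - intros z; rewrite sigma_inr.
    (* For a constant partial map the pullback of [g] extends along the [z]-line of the cone, which
       is defined over all of [I]. *)
    apply (segal_lift_unique g i (fun _ => z)
      (fun s => g (existT _ (projT1 s) (join_inr PO z)))).
    intros [k w]; simpl; revert w.
    apply (join_ext PO (fun _ => g (existT _ k (join_inr PO z)))
      (fun w => g (cone_map PO (fun _ => z) (existT _ k w))) HC).
    (* At the cone point the glue path moves [inl e] onto the [z]-line. *)
    + intros e; rewrite cone_map_inl, (join_glue PO e z); reflexivity.
    + intros p; rewrite cone_map_inr; reflexivity.
Qed.

End Completeness.

Theorem mainTheorem1 (PO : pushouts) (I : interval) (I01 : consistent I)
    (C : Type) :
  is_set C -> based_segal_complete PO I C -> sierpinski_complete PO I I01 C.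
Proof.
  intros HC segal Z.
  apply (is_equiv_of_inverse _ (segal_lift PO I C segal Z)).
  - apply is_set_arrow, HC.
  - intros g; apply functional_extensionality; intros w.
    apply segal_lift_sigma, HC.
  - intros G; apply functional_extensionality; intros y.
    apply segal_lift_restrict, HC.
Qed.
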